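(* Let $x$ and $g$ be (jointly distributed) random vectors in $\mathbb{R}^n$ and $\mathbb{R}^m$ such that $H:=\mathbb{E}[(x\otimes g)(x\otimes g)^T]\in\mathbb{R}^{mn\times mn}$ exists and is positive definite, and put $G:=gx^T\in\mathbb{R}^{m\times n}$. For symmetric positive definite $A\in\mathbb{R}^{n\times n}$ and $B\in\mathbb{R}^{m\times m}$ define $$\Phi(H,A\otimes B):=\frac{\operatorname{tr}\!\big(H(A\otimes B)^{-1}\big)/(mn)}{|H|^{1/(mn)}\,|A|^{-1/n}\,|B|^{-1/m}}.$$ Then: (i) for fixed positive definite $A$, a positive definite $B$ minimizes $B\mapsto\Phi(H,A\otimes B)$ over all positive definite $m\times m$ matrices if and only if $B=c\,\mathbb{E}[GA^{-1}G^T]=c\,\mathbb{E}[(x^TA^{-1}x)\,gg^T]$ for some $c>0$; (ii) for fixed positive definite $B$, a positive definite $A$ minimizes $A\mapsto\Phi(H,A\otimes B)$ over all positive definite $n\times n$ matrices if and only if $A=c\,\mathbb{E}[G^TB^{-1}G]=c\,\mathbb{E}[(g^TB^{-1}g)\,xx^T]$ for some $c>0$.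
   Context: $|M|$ denotes the determinant of a square matrix $M$ and $\otimes$ the Kronecker product. *)

(* Defs.v *)
From HB Require Import structures.
From mathcomp Require Import all_boot all_order all_algebra.
From mathcomp.real_closed Require Export mxtens.
From mathcomp Require Import all_classical all_reals all_analysis.

Set Implicit Arguments.
Unset Strict Implicit.
Unset Printing Implicit Defensive.

Import Order.TTheory GRing.Theory Num.Theory.
Local Open Scope ring_scope.

Section PositiveDefinite.
Context {R : realType} {n : nat}.

Definition posdefmx (A : 'M[R]_n) : Prop :=
  A^T = A /\ forall v : 'cV[R]_n, v != 0 -> 0 < (v^T *m A *m v) 0 0.

Definition minimizes_posdef (f : 'M[R]_n -> R) (A : 'M[R]_n) : Prop :=
  posdefmx A /\ forall A' : 'M[R]_n, posdefmx A' -> f A <= f A'.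

End PositiveDefinite.

Section RandomMatrices.
Context {R : realType} {d : measure_display} {T : measurableType d}.
Context {p q : nat}.

(* Measurability of all entries is Borel measurability of M, the Borel sigma-
   algebra of a finite-dimensional real space being the product one. *)
Definition random_mx (M : T -> 'M[R]_(p, q)) : Prop :=
  forall i j, measurable_fun setT (fun t => M t i j).

(* The expectation of M exists (as a real matrix). *)
Definition integrable_mx (P : probability T R) (M : T -> 'M[R]_(p, q)) : Prop :=
  forall i j, P.-integrable setT (EFin \o (fun t => M t i j)).

(* Meaningful under integrable_mx P M; fine sends infinite values to 0. *)
Definition expectation_mx (P : probability T R) (M : T -> 'M[R]_(p, q)) :
    'M[R]_(p, q) :=
  \matrix_(i, j) fine ('E_P[(fun t => M t i j)])%E.

End RandomMatrices.

(* tensmx (infix *t) is the Kronecker product: the entry of A *t B at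
   row i * m + k, column j * m + l is A i j * B k l when B has size m. *)
Definition Phi {R : realType} {n m : nat} (H : 'M[R]_(n * m))
    (A : 'M[R]_n) (B : 'M[R]_m) : R :=
  (\tr (H *m invmx (A *t B)) / (m * n)%:R) /
  ((\det H) `^ ((m * n)%:R^-1) * (\det A) `^ (- n%:R^-1)
    * (\det B) `^ (- m%:R^-1)).

(* Main.v *)
Require Import Defs.
From HB Require Import structures.
From mathcomp Require Import all_boot all_order all_algebra.
From mathcomp Require Import all_classical all_reals all_analysis.
From mathcomp Require Import ring.

Set Implicit Arguments.
Unset Strict Implicit.
Unset Printing Implicit Defensive.

Import Order.TTheory GRing.Theory Num.Theory.
Local Open Scope ring_scope.

(** With [S := E[G A^-1 G^T]] one has [tr (S X) = tr (H (A^-1 *t X))] for every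
    [X], so that up to a positive factor independent of [B] the objective is
    [tr (S B^-1) |B|^(1/m)], and [S] is positive definite because [H] is.
    Factoring [B^-1 = L L^T], the matrix [M := L^T S L] is positive definite with
    [tr M = tr (S B^-1)] and [|M| = |S| / |B|]; the inequality
    [|M| <= (tr M / m)^m], an equality exactly when [M] is scalar, then says that
    the minimum is attained exactly at the positive multiples of [S]. Part (ii)
    is the same argument on the other tensor factor. *)

(** * Positive definite matrices: congruence, Schur complement, Cholesky factor *)

Lemma posdefmx_unit (R : realType) n (A : 'M[R]_n) :
  posdefmx A -> A \in unitmx.
Proof.
move=> [symA posA]; rewrite -row_free_unit -kermx_eq0.
(* A nonzero row of the kernel would be an isotropic vector of the quadratic form. *)
apply/eqP/row_matrixP => i; rewrite row0; apply/eqP; apply: contraT => ri0.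
have := posA (row i (kermx A))^T; rewrite trmx_eq0 => /(_ ri0).
by rewrite trmxK -row_mul mulmx_ker row0 mul0mx mxE ltxx.
Qed.

Lemma posdefmx_congr (R : realType) n (A W : 'M[R]_n) :
  W \in unitmx -> posdefmx A -> posdefmx (W^T *m A *m W).
Proof.
move=> uW [symA posA]; split; first by rewrite !trmx_mul trmxK symA mulmxA.
move=> v v0; have -> : v^T *m (W^T *m A *m W) *m v = (W *m v)^T *m A *m (W *m v).
  by rewrite trmx_mul !mulmxA.
apply: posA; apply: contra_neq v0 => Wv0.
by rewrite -(mulKmx uW v) Wv0 mulmx0.
Qed.

(** By symmetry the inverse is the congruence of [A] by [invmx A]. *)
Lemma posdefmx_inv (R : realType) n (A : 'M[R]_n) :
  posdefmx A -> posdefmx (invmx A).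
Proof.
move=> pA; have uA := posdefmx_unit pA; have := posdefmx_congr _ pA.
move/(_ (invmx A)); rewrite unitmx_inv mulmxK // => /(_ uA).
by rewrite trmx_inv pA.1.
Qed.

Lemma posdefmx_schur (R : realType) n (a : R) (b : 'cV[R]_n) (C : 'M[R]_n) :
  posdefmx (block_mx a%:M b^T b C : 'M[R]_(1 + n)%N) ->
  0 < a /\ posdefmx (C - a^-1 *: (b *m b^T)).
Proof.
move=> [symA posA].
have a0 : 0 < a.
  have := posA (col_mx 1%:M 0); rewrite tr_col_mx trmx1 trmx0.
  rewrite mul_row_block mul_row_col !mul0mx !addr0 mulmx0 addr0 mulmx1 mul1mx.
  rewrite mxE eqxx; apply.
  by rewrite col_mx_eq0 negb_and -scalemx1 scale1r oner_eq0.
split=> //; split.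
  move: symA; rewrite tr_block_mx => /eq_block_mx[_ _ _ symC].
  by rewrite linearB linearZ /= symC trmx_mul trmxK.
(* For fixed [v] this first coordinate minimizes the quadratic form, and the minimum is the value of
   the Schur complement at [v]. *)
move=> v v0; have := posA (col_mx (- (a^-1 *: (b^T *m v))) v).
rewrite col_mx_eq0 negb_and v0 orbT => /(_ isT).
congr (_ < _); congr (fun_of_matrix _ _ _).
have -> : (col_mx (- (a^-1 *: (b^T *m v))) v)^T
    = row_mx (- (a^-1 *: (v^T *m b))) v^T.
  by rewrite tr_col_mx linearN linearZ /= trmx_mul trmxK.
rewrite mul_row_block mul_row_col mul_mx_scalar scalerN scalerA.
rewrite divff ?gt_eqF // scale1r addNr mul0mx add0r.
rewrite mulmxBr mulmxBl mulmxDl addrC mulNmx -!scalemxAl -!scalemxAr -scalemxAl !mulmxA.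
by rewrite mulNmx -scalemxAl.
Qed.

(** Induction on the size, one row and column at a time: the Schur complement of the corner [a] is
    again positive definite, and its factor [L] becomes the lower right block. *)
Lemma posdefmx_cholesky (R : realType) n (A : 'M[R]_n) : posdefmx A ->
  exists2 L : 'M[R]_n, is_trig_mx L & A = L *m L^T.
Proof.
elim: n A => [|n IHn].
  by move=> A _; exists 0; [exact: mx0_is_trig | apply/matrixP => -[]].
rewrite -[n.+1]/(1 + n)%N => A; rewrite -[A]submxK [ulsubmx _]mx11_scalar => pA.
set a := ulsubmx _ 0 0 in pA |- *; set b := dlsubmx _ in pA |- *.
set C := drsubmx _ in pA |- *.
have rE : ursubmx A = b^T.
  by have := pA.1; rewrite tr_block_mx => /eq_block_mx[].
move: pA; rewrite rE => /[dup] pA /posdefmx_schur[a0 /IHn[L tL LE]].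
exists (block_mx (Num.sqrt a)%:M 0 ((Num.sqrt a)^-1 *: b) L).
  by rewrite (@is_trig_block_mx _ 1 n 1 n) // eqxx mx11_is_trig.
have s0 : Num.sqrt a != 0 by rewrite gt_eqF ?sqrtr_gt0.
rewrite tr_block_mx mulmx_block -LE !trmx0 !mulmx0 !mul0mx !addr0.
rewrite tr_scalar_mx -scalar_mxM -expr2 sqr_sqrtr ?ltW // linearZ /=.
rewrite mul_scalar_mx mul_mx_scalar !scalerA divff // scale1r.
congr block_mx; rewrite ?scale1r //.
by rewrite -scalemxAl -scalemxAr scalerA -invfM -expr2 sqr_sqrtr ?ltW // addrC subrK.
Qed.

(** * Determinant and trace inequalities *)

Lemma posdefmx_det_gt0 (R : realType) n (A : 'M[R]_n) : posdefmx A -> 0 < \det A.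
Proof.
move=> pA; have uA := posdefmx_unit pA; have [L _ AE] := posdefmx_cholesky pA.
move: uA; rewrite unitmxE AE det_mulmx det_tr -expr2 unitfE lt0r => ->.
exact: sqr_ge0.
Qed.

(** By cyclicity the trace is the sum of the quadratic form of [A] over the columns of [W]; no term
    is negative, and a nonzero column gives a positive one. *)
Lemma posdefmx_trace_gt0 (R : realType) n k (A : 'M[R]_n) (W : 'M[R]_(n, k)) :
  posdefmx A -> W != 0 -> 0 < \tr (A *m (W *m W^T)).
Proof.
move=> [symA posA] W0; rewrite mulmxA mxtrace_mulC mulmxA.
have diagE j : (W^T *m A *m W) j j = ((col j W)^T *m A *m col j W) 0 0.
  by rewrite tr_col -row_mul !mxE; apply: eq_bigr => i _; rewrite !mxE.
have ge0 j : 0 <= (W^T *m A *m W) j j.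
  rewrite diagE; have [->|/posA/ltW //] := eqVneq (col j W) 0.
  by rewrite mulmx0 mxE.
have [j j0] : exists j, col j W != 0.
  apply/existsP; apply: contraNT W0 => /existsPn cW0.
  by apply/eqP/matrixP => i j; have /eqP/colP/(_ i) := negbNE (cW0 j); rewrite !mxE.
rewrite /mxtrace (bigD1 j) //= ltr_wpDr ?sumr_ge0 //.
by rewrite diagE posA.
Qed.

(* Hadamard's inequality and AM-GM: with [A = L L^T], the determinant is the
   product of the squared diagonal entries of [L], while the trace is the sum of
   the squares of all entries. *)
Lemma det_le_trace (R : realType) n (A : 'M[R]_n) : posdefmx A ->
  \det A <= (\tr A / n%:R) ^+ n ?= iff is_scalar_mx A.
Proof.
move=> /posdefmx_cholesky[L tL AE].
have trE : \tr A = \sum_i \sum_j L i j ^+ 2.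
  rewrite AE; apply: eq_bigr => i _; rewrite mxE.
  by apply: eq_bigr => j _; rewrite mxE.
have detE : \det A = \prod_i L i i ^+ 2.
  by rewrite AE det_mulmx det_tr det_trig // -big_split.
have := @leif_AGM R 'I_n predT (fun i => L i i ^+ 2) (fun i _ => sqr_ge0 _).
rewrite /= cardT size_enum_ord -detE => AGM.
have le_diag i : L i i ^+ 2 <= \sum_j L i j ^+ 2
    ?= iff [forall (j | j != i), L i j == 0].
  rewrite (bigD1 i) //= -[X in X <= _ ?= iff _]addr0.
  rewrite -[[forall (j | _), _]]andTb; apply: leifD; first exact/leif_refl.
  apply: leif_0_sum => j _; apply/leifP; case: eqP => [->|/eqP Lij].
    by rewrite expr0n.
  by rewrite exprn_even_gt0.
have le_tr : \sum_i L i i ^+ 2 <= \tr A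
    ?= iff [forall i, forall (j | j != i), L i j == 0].
  by rewrite trE; apply: leif_sum => i _; exact: le_diag.
(* Size 0 is settled apart, since the mean of the trace divides by the size; there both sides are
   1. *)
case: n => [|n] in A L tL AE trE detE AGM le_diag le_tr *.
  rewrite expr0 det_mx00; apply/leifP.
  rewrite (_ : is_scalar_mx A) ?eqxx //.
  by apply/is_scalar_mxP; exists 0; apply/matrixP => -[].
have le_pow : ((\sum_i L i i ^+ 2) / n.+1%:R) ^+ n.+1 <= (\tr A / n.+1%:R) ^+ n.+1
    ?= iff [forall i, forall (j | j != i), L i j == 0].
  have sum0 : 0 <= \sum_i L i i ^+ 2 by apply: sumr_ge0 => i _; exact: sqr_ge0.
  rewrite (mono_in_leif (ler_pXn2r _)) ?nnegrE ?divr_ge0 ?(le_trans sum0 le_tr.1) //.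
  by rewrite (mono_leif (ler_pM2r _)) // invr_gt0 ltr0Sn.
(* Equality in AM-GM makes the squared diagonal entries of [L] equal, equality in [le_pow] makes [L]
   diagonal; together they make [L *m L^T] scalar. *)
have le_tot := leif_trans AGM le_pow.
split; first exact: le_tot.1.
apply/idP/is_scalar_mxP => [|[a Aa]]; last first.
  rewrite Aa det_scalar mxtrace_scalar.
  by rewrite -[a *+ _]mulr_natr mulfK // pnatr_eq0.
rewrite le_tot.2 => /andP[/forallP eqL /forallP diagL].
exists (L 0 0 ^+ 2); apply/matrixP => i j; rewrite AE !mxE (bigD1 i) //= mxE.
rewrite big1 ?addr0 => [|k ki]; last first.
  by have /forallP/(_ k) := diagL i; rewrite ki => /eqP ->; rewrite mul0r.
have [<-|ij] := eqVneq i j.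
  by have /forallP/(_ 0) := eqL i => /eqP <-.
by have /forallP/(_ i) := diagL j; rewrite ij => /eqP ->; rewrite mulr0.
Qed.

Lemma det_le_trace_mul_inv (R : realType) n (S B : 'M[R]_n) :
  posdefmx S -> posdefmx B ->
  \det S <= (\tr (S *m invmx B) / n%:R) ^+ n * \det B
    ?= iff is_scalar_mx (S *m invmx B).
Proof.
move=> pS pB; have uB := posdefmx_unit pB; have dB := posdefmx_det_gt0 pB.
have [L _ VE] := posdefmx_cholesky (posdefmx_inv pB); set V := invmx B in VE *.
have uL : L \in unitmx.
  by have := uB; rewrite -unitmx_inv -/V VE unitmx_mul => /andP[].
have pM := posdefmx_congr uL pS; set M := _ *m L in pM.
have trM : \tr (S *m V) = \tr M by rewrite VE mulmxA mxtrace_mulC mulmxA.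
have detM : \det M * \det B = \det S.
  have dV : \det L * \det L * \det B = 1.
    by rewrite -{2}(det_tr L) -det_mulmx -VE -det_mulmx mulVmx // det1.
  rewrite /M !det_mulmx det_tr.
  by rewrite -[RHS]mulr1 -dV; ring.
(* [S *m V] need not be symmetric, but it is similar to [M] through [L^T], and conjugation fixes
   scalar matrices. *)
have scM : is_scalar_mx (S *m V) = is_scalar_mx M.
  have uLT : L^T \in unitmx by rewrite unitmx_tr.
  have SVE : S *m V = invmx L^T *m M *m L^T.
    by rewrite VE /M !mulmxA mulVmx // mul1mx.
  apply/is_scalar_mxP/is_scalar_mxP => -[a aE]; exists a; last first.
    by rewrite SVE aE scalar_mxC mulmxKV.
  have ME : M = L^T *m (S *m V) *m invmx L^T.
    by rewrite SVE !mulmxA mulmxV // mul1mx mulmxK.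
  by rewrite ME aE scalar_mxC mulmxK.
by rewrite -detM trM scM (mono_leif (ler_pM2r dB)); exact: det_le_trace.
Qed.

(** * Minimizers of the reduced objective *)

(** On positive definite matrices [f] is a positive multiple of the [n]-th root of [h], so both have
    the same minimizers. By [det_le_trace_mul_inv], [h] is bounded below by [\det S], which does not
    depend on [B], with equality exactly when [S *m invmx B] is scalar. *)
Lemma minimizes_posdef_trace_inv (R : realType) n (S : 'M[R]_n) (f : 'M[R]_n -> R)
    (k : R) :
  (0 < n)%N -> posdefmx S -> 0 < k ->
  (forall B, posdefmx B ->
    f B = k * (\tr (S *m invmx B) * (\det B) `^ n%:R^-1)) ->
  forall B, posdefmx B ->
  minimizes_posdef f B <-> exists2 c : R, 0 < c & B = c *: S.
Proof.
move=> n0 pS k0 fE.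
have nR : 0 < n%:R :> R by rewrite ltr0n.
pose h (B : 'M[R]_n) := (\tr (S *m invmx B) / n%:R) ^+ n * \det B.
have tr_gt0 B : posdefmx B -> 0 < \tr (S *m invmx B).
  move=> pB; have [L _ LE] := posdefmx_cholesky (posdefmx_inv pB).
  rewrite LE; apply: posdefmx_trace_gt0 => //.
  (* A zero factor would make the inverse of [B] zero, which is singular because the size is
     positive. *)
  apply: contraTneq (posdefmx_unit (posdefmx_inv pB)) => L0.
  rewrite LE L0 mul0mx unitmxE -(scale0r 1%:M) detZ expr0n.
  by rewrite eqn0Ngt n0 mul0r unitr0.
have h_ge0 B : posdefmx B -> h B \in Num.nneg.
  move=> pB; rewrite nnegrE mulr_ge0 ?exprn_ge0 ?divr_ge0 ?ltW ?tr_gt0 //.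
  exact: posdefmx_det_gt0.
have fhE B : posdefmx B -> f B = k * n%:R * (h B) `^ n%:R^-1.
  move=> pB; have t0 := tr_gt0 _ pB; have d0 := posdefmx_det_gt0 pB.
  rewrite fE // powRM ?exprn_ge0 ?divr_ge0 ?ltW //.
  rewrite -powR_mulrn ?divr_ge0 ?ltW // -powRrM divff ?gt_eqF //.
  rewrite powRr1 ?divr_ge0 ?ltW // -mulrA; congr (_ * _).
  by rewrite [RHS]mulrA; congr (_ * _); rewrite mulrC divfK ?gt_eqF.
have f_leE B B' : posdefmx B -> posdefmx B' -> (f B <= f B') = (h B <= h B').
  move=> pB pB'; rewrite !fhE // ler_pM2l ?mulr_gt0 //.
  apply: (le_mono_in (gt0_ltr_powR _)); rewrite ?invr_gt0 // h_ge0 //.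
have h_min B : posdefmx B -> \det S <= h B ?= iff is_scalar_mx (S *m invmx B).
  exact: det_le_trace_mul_inv.
have uS := posdefmx_unit pS.
(* A minimizer is compared with [S], where [h] attains the bound; this forces equality at [B], and
   the positive trace gives the sign of the scalar. *)
move=> B pB; have uB := posdefmx_unit pB; split=> [[_ /(_ _ pS)]|[c c0 BE]].
  rewrite f_leE //; have /eqP <- : \det S == h S.
    by rewrite (h_min _ pS).2 mulmxV // scalar_mx_is_scalar.
  rewrite (ge_leif (h_min _ pB)) => /is_scalar_mxP[a SVa].
  have a0 : 0 < a.
    by have := tr_gt0 _ pB; rewrite SVa mxtrace_scalar -mulr_natr pmulr_lgt0.
  exists a^-1; rewrite ?invr_gt0 //.
  have -> : S = a *: B by rewrite -mul_scalar_mx -SVa mulmxKV.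
  by rewrite scalerA mulVf ?scale1r ?gt_eqF.
split=> // B' pB'; rewrite f_leE //.
suff /eqP <- : \det S == h B by exact: (h_min _ pB').1.
rewrite (h_min _ pB).2 BE; apply/is_scalar_mxP; exists c^-1.
by rewrite invmxZ -?BE // -scalemxAr mulmxV // scalemx1.
Qed.

(** * Kronecker products and traces of rank-one matrices *)

Lemma mxtrace_tens (R : comPzRingType) n m (A : 'M[R]_n) (B : 'M[R]_m) :
  \tr (A *t B) = \tr A * \tr B.
Proof. by rewrite mulr_sum; apply: eq_bigr => i _; rewrite mxE. Qed.

Lemma tensmx_neq0 (R : idomainType) m n p q (A : 'M[R]_(m, n)) (B : 'M[R]_(p, q)) :
  A != 0 -> B != 0 -> A *t B != 0.
Proof.
move=> /matrix0Pn[i [j Aij]] /matrix0Pn[k [l Bkl]]; apply/matrix0Pn.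
exists (mxtens_index (i, k)), (mxtens_index (j, l)).
by rewrite tensmxE mulf_neq0.
Qed.

Lemma tensmx11 (R : comPzRingType) n m :
  (1%:M : 'M[R]_n) *t (1%:M : 'M[R]_m) = 1%:M.
Proof.
apply/matrixP => i j; case: (mxtens_indexP i) => i0 i1; case: (mxtens_indexP j) => j0 j1.
rewrite tensmxE !mxE (can_eq (@mxtens_indexK _ _)) xpair_eqE.
by case: eqP; case: eqP; rewrite ?(mul0r, mulr0, mulr1).
Qed.

Lemma invmx_tens (R : comUnitRingType) n m (A : 'M[R]_n) (B : 'M[R]_m) :
  A \in unitmx -> B \in unitmx -> invmx (A *t B) = invmx A *t invmx B.
Proof.
move=> uA uB; have AB1 : (A *t B) *m (invmx A *t invmx B) = 1%:M.
  by rewrite tensmx_mul !mulmxV // tensmx11.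
have [uAB _] := mulmx1_unit AB1.
by rewrite -[RHS](mulKmx uAB) AB1 mulmx1.
Qed.

Lemma mxtrace_mul_delta (R : pzRingType) m n (A : 'M[R]_(m, n)) i j :
  \tr (A *m delta_mx j i) = A i j.
Proof.
rewrite /mxtrace (bigD1 i) //= big1 ?addr0 => [|k ki]; rewrite mxE.
  rewrite (bigD1 j) //= big1 ?addr0 => [|l lj]; first by rewrite mxE !eqxx mulr1.
  by rewrite mxE (negPf lj) mulr0.
by rewrite big1 // => l _; rewrite mxE (negPf ki) andbF mulr0.
Qed.

Lemma mxtrace_tens_rank1 (R : comPzRingType) n m (x : 'cV[R]_n) (g : 'cV[R]_m)
    (A : 'M[R]_n) (B : 'M[R]_m) :
  \tr ((x *t g) *m (x *t g)^T *m (A *t B))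
  = (x^T *m A *m x) 0 0 * (g^T *m B *m g) 0 0.
Proof.
by rewrite -mulmxA mxtrace_mulC trmx_tens !tensmx_mul mxtrace_tens !trace_mx11.
Qed.

Lemma mxtrace_scale_rank1 (R : comPzRingType) n (a : R) (g : 'cV[R]_n) (B : 'M[R]_n) :
  \tr (a *: (g *m g^T) *m B) = a * (g^T *m B *m g) 0 0.
Proof.
by rewrite -scalemxAl mxtraceZ -mulmxA mxtrace_mulC trace_mx11.
Qed.

Lemma rank1_congr (R : comPzRingType) n m (x : 'cV[R]_n) (g : 'cV[R]_m)
    (A : 'M[R]_n) :
  (g *m x^T) *m A *m (g *m x^T)^T = (x^T *m A *m x) 0 0 *: (g *m g^T).
Proof.
rewrite trmx_mul trmxK scalemxAr -mul_scalar_mx -mx11_scalar.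
by rewrite !mulmxA.
Qed.

(** * Expectations of random matrices, tested by traces *)

Section ExpectationTrace.
Context {R : realType} {d : measure_display} {T : measurableType d}.
Variable P : probability T R.

Lemma integrable_mx_trace q (M : T -> 'M[R]_q) (X : 'M[R]_q) :
  integrable_mx P M -> P.-integrable setT (EFin \o (fun t => \tr (M t *m X))).
Proof.
move=> iM; rewrite (_ : _ \o _ = fun t =>
    (\sum_i \sum_j (X j i)%:E * (M t i j)%:E)%E); last first.
  apply/funext => t /=; rewrite -sumEFin; apply: eq_bigr => i _.
  by rewrite mxE -sumEFin; apply: eq_bigr => j _; rewrite mulrC.
apply: integrable_sum => // i _; apply: integrable_sum => // j _.
by apply: integrableZl => //; exact: iM.
Qed.

Lemma expectation_mx_trace q (M : T -> 'M[R]_q) (X : 'M[R]_q) :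
  integrable_mx P M ->
  \tr (expectation_mx P M *m X) = fine ('E_P[(fun t => \tr (M t *m X)%R)])%E.
Proof.
move=> iM; have iXM i j : P.-integrable setT (fun t => (X j i)%:E * (M t i j)%:E)%E.
  by apply: integrableZl => //; exact: iM.
have -> : ('E_P[(fun t => \tr (M t *m X)%R)] =
    \sum_i \sum_j (X j i)%:E * 'E_P[(fun t => M t i j)])%E.
  rewrite unlock; transitivity
     (\int[P]_t (\sum_i \sum_j (X j i)%:E * (M t i j)%:E))%E.
    apply: eq_integral => t _ /=; rewrite -sumEFin; apply: eq_bigr => i _.
    by rewrite mxE -sumEFin; apply: eq_bigr => j _; rewrite mulrC.
  rewrite integral_sum // => [|i]; last exact: integrable_sum.
  apply: eq_bigr => i _; rewrite integral_sum //; apply: eq_bigr => j _.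
  by rewrite integralZl //; exact: iM.
(* [fine] commutes with these sums and products because every entry has a finite expectation. *)
have finE i j : 'E_P[(fun t => M t i j)]%E \is a fin_num.
  by rewrite unlock; apply: integrable_fin_num => //; exact: iM.
rewrite -sum_fine => [|i _]; last by apply/sum_fin_numP => j _ _; rewrite fin_numM.
apply: eq_bigr => i _; rewrite -sum_fine => [|j _]; last by rewrite fin_numM.
by rewrite mxE; apply: eq_bigr => j _; rewrite mxE fineM // mulrC.
Qed.

(** Testing against [delta_mx j i] turns each entry of [N] into a trace against [M], so
    integrability passes from [M] to [N]. Applied with [M := xg], it yields the integrability of
    [GAG] and [GBG]. *)
Lemma expectation_mx_dual q p (M : T -> 'M[R]_q) (N : T -> 'M[R]_p)
    (F : 'M[R]_p -> 'M[R]_q) :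
  integrable_mx P M ->
  (forall t X, \tr (N t *m X) = \tr (M t *m F X)) ->
  integrable_mx P N /\
  forall X, \tr (expectation_mx P N *m X) = \tr (expectation_mx P M *m F X).
Proof.
move=> iM trE.
have iN : integrable_mx P N.
  move=> i j; have := integrable_mx_trace (F (delta_mx j i)) iM.
  congr (integrable _ _ (_ \o _)); apply/funext => t; rewrite -trE.
  by rewrite mxtrace_mul_delta.
split=> // X; rewrite !expectation_mx_trace //.
by congr (fine _); congr expectation; apply/funext => t; exact: trE.
Qed.

End ExpectationTrace.

(** The value of the form at [v] is the trace of [S] against [v *m v^T], hence a trace of [H]
    against a nonzero Gram matrix, positive by [posdefmx_trace_gt0]. *)
Lemma posdefmx_of_trace (R : realType) n q (H : 'M[R]_q) (S : 'M[R]_n)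
    (F : 'M[R]_n -> 'M[R]_q) :
  posdefmx H -> S^T = S -> (forall X, \tr (S *m X) = \tr (H *m F X)) ->
  (forall v : 'cV[R]_n, v != 0 ->
    exists p (W : 'M[R]_(q, p)), W != 0 /\ F (v *m v^T) = W *m W^T) ->
  posdefmx S.
Proof.
move=> pH symS trE FE; split=> // v /FE[p [W [W0 WE]]].
by rewrite -trace_mx11 -mulmxA mxtrace_mulC -mulmxA trE WE posdefmx_trace_gt0.
Qed.

Theorem mainTheorem3 (R : realType) (d : measure_display)
    (T : measurableType d) (P : probability T R) (n m : nat)
    (hn : (0 < n)%N) (hm : (0 < m)%N)
    (x : T -> 'cV[R]_n) (g : T -> 'cV[R]_m)
    (hx : random_mx x) (hg : random_mx g) :
  let xg : T -> 'M[R]_(n * m) := fun t => (x t *t g t) *m (x t *t g t)^T in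
  let H : 'M[R]_(n * m) := expectation_mx P xg in
  let G : T -> 'M[R]_(m, n) := fun t => g t *m (x t)^T in
  integrable_mx P xg ->
  posdefmx H ->
  (* (i) *)
  (forall A : 'M[R]_n, posdefmx A ->
    let GAG : T -> 'M[R]_m := fun t => G t *m invmx A *m (G t)^T in
    let xAx : T -> R := fun t => ((x t)^T *m invmx A *m x t) 0 0 in
    [/\ integrable_mx P GAG,
        expectation_mx P GAG
          = expectation_mx P (fun t => xAx t *: (g t *m (g t)^T)) &
        forall B : 'M[R]_m, posdefmx B ->
          (minimizes_posdef (fun B' => Phi H A B') B <->
           exists2 c : R, 0 < c & B = c *: expectation_mx P GAG)]) /\
  (* (ii) *)
  (forall B : 'M[R]_m, posdefmx B ->
    let GBG : T -> 'M[R]_n := fun t => (G t)^T *m invmx B *m G t in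
    let gBg : T -> R := fun t => ((g t)^T *m invmx B *m g t) 0 0 in
    [/\ integrable_mx P GBG,
        expectation_mx P GBG
          = expectation_mx P (fun t => gBg t *: (x t *m (x t)^T)) &
        forall A : 'M[R]_n, posdefmx A ->
          (minimizes_posdef (fun A' => Phi H A' B) A <->
           exists2 c : R, 0 < c & A = c *: expectation_mx P GBG)]).
Proof.
move=> xg H G iH pH.
have dH := posdefmx_det_gt0 pH.
split=> [A pA GAG xAx | B pB GBG gBg].
- pose V := invmx A; have pV : posdefmx V := posdefmx_inv pA.
  have GAGE t : GAG t = xAx t *: (g t *m (g t)^T) by exact: rank1_congr.
  have trE t X : \tr (GAG t *m X) = \tr (xg t *m (V *t X)).
    by rewrite GAGE mxtrace_scale_rank1 mxtrace_tens_rank1.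
  have [iG trG] := expectation_mx_dual (F := fun X => V *t X) iH trE.
  have symG : (expectation_mx P GAG)^T = expectation_mx P GAG.
    apply/matrixP => i j; rewrite !mxE; congr (fine _); congr expectation.
    by apply/funext => t; rewrite !GAGE !mxE !big_ord1 !mxE [g t i 0 * _]mulrC.
  have pG : posdefmx (expectation_mx P GAG).
    apply: (posdefmx_of_trace pH symG trG) => v v0.
    (* With [V = L *m L^T], the mixed product rule writes [V *t (v *m v^T)] as the Gram matrix of
       [L *t v]. *)
    have [L _ LE] := posdefmx_cholesky pV.
    exists (n * 1)%N, (L *t v); split; last by rewrite trmx_tens tensmx_mul -LE.
    apply: tensmx_neq0 => //; apply: contraTneq (posdefmx_det_gt0 pV) => L0.
    by rewrite LE L0 mul0mx -(scale0r 1%:M) detZ expr0n eqn0Ngt hn mul0r ltxx.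
  split=> //; first by congr expectation_mx; apply/funext => t; exact: GAGE.
  (* The constant [k] collects the factors of [Phi] free of [B]; the power [-1/m] of [\det B] in the
     denominator becomes [1/m] in the numerator. *)
  apply: (minimizes_posdef_trace_inv (f := fun B => Phi H A B)
    (k := ((m * n)%:R * (\det H `^ (m * n)%:R^-1 * \det A `^ (- n%:R^-1)))^-1)) => //.
    by rewrite invr_gt0 !mulr_gt0 ?powR_gt0 ?posdefmx_det_gt0 // ltr0n muln_gt0 hm.
  move=> B pB; rewrite /Phi invmx_tens ?posdefmx_unit // -/V trG.
  by rewrite [_ `^ (- m%:R^-1)]powRN !invfM invrK; ring.
(* Transposing [G] exchanges [x] and [g], so the fixed inverse now sits in the right Kronecker
   factor. *)
- pose V := invmx B; have pV : posdefmx V := posdefmx_inv pB.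
  have GBGE t : GBG t = gBg t *: (x t *m (x t)^T).
    by rewrite -rank1_congr /GBG /G trmx_mul trmxK trmx_mul trmxK.
  have trE t X : \tr (GBG t *m X) = \tr (xg t *m (X *t V)).
    by rewrite GBGE mxtrace_scale_rank1 mxtrace_tens_rank1 mulrC.
  have [iG trG] := expectation_mx_dual (F := fun X => X *t V) iH trE.
  have symG : (expectation_mx P GBG)^T = expectation_mx P GBG.
    apply/matrixP => i j; rewrite !mxE; congr (fine _); congr expectation.
    by apply/funext => t; rewrite !GBGE !mxE !big_ord1 !mxE [x t i 0 * _]mulrC.
  have pG : posdefmx (expectation_mx P GBG).
    apply: (posdefmx_of_trace pH symG trG) => v v0.
    have [L _ LE] := posdefmx_cholesky pV.
    exists (1 * m)%N, (v *t L); split; last by rewrite trmx_tens tensmx_mul -LE.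
    apply: tensmx_neq0 => //; apply: contraTneq (posdefmx_det_gt0 pV) => L0.
    by rewrite LE L0 mul0mx -(scale0r 1%:M) detZ expr0n eqn0Ngt hm mul0r ltxx.
  split=> //; first by congr expectation_mx; apply/funext => t; exact: GBGE.
  apply: (minimizes_posdef_trace_inv (f := fun A => Phi H A B)
    (k := ((m * n)%:R * (\det H `^ (m * n)%:R^-1 * \det B `^ (- m%:R^-1)))^-1)) => //.
    by rewrite invr_gt0 !mulr_gt0 ?powR_gt0 ?posdefmx_det_gt0 // ltr0n muln_gt0 hm.
  move=> A pA; rewrite /Phi invmx_tens ?posdefmx_unit // -/V trG.
  by rewrite [_ `^ (- n%:R^-1)]powRN !invfM invrK; ring.
Qed.
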